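(* Let $\Omega$ be a Polish space and $(T(t))_{t\ge0}\subset\mathscr{L}(\mathscr{M}(\Omega),\sigma)$ a stochastically continuous Markovian semigroup, and let $\mu\in\mathscr{M}(\Omega)$ be an invariant probability measure ($T(t)\mu=\mu$ for all $t\ge0$). If the semigroup is $t_0$-regular for some $t_0>0$, then \[\lim_{t\to\infty}T(t)\nu=\nu(\Omega)\,\mu\] in the total variation norm of $\mathscr{M}(\Omega)$ for every $\nu\in\mathscr{M}(\Omega)$. Moreover, $\mu$ is the unique invariant probability measure, and $\mu$ is equivalent to $k_t(x,\cdot)$ for all $t\ge t_0$ and $x\in\Omega$.
   Context: $\mathscr{M}(\Omega)$: finite signed Borel measures with total variation norm. A weakly continuous operator is one of the form $(T\mu)(A)=\int k(x,A)\,d\mu(x)$ with $k$ a bounded transition kernel (map $\Omega\times\mathscr{B}(\Omega)\to\mathbb{R}$, signed measure in the second variable, Borel measurable in the first, $\sup_x\lvert k\rvert(x,\Omega)<\infty$); $\mathscr{L}(\mathscr{M}(\Omega),\sigma)$ is the space of such operators. A semigroup $(T(t))_{t\ge0}$ satisfies $T(0)=I$, $T(t+s)=T(t)T(s)$; $k_t$ denotes the kernel of $T(t)$. It is Markovian if each $k_t(x,\cdot)$ is a probability measure; stochastically continuous if $\lim_{t\to0}\int_\Omega f(y)\,k_t(x,dy)=f(x)$ for all bounded continuous $f$ and all $x\in\Omega$; $t_0$-regular ($t_0>0$) if $k_{t_0}(x,\cdot)$ and $k_{t_0}(y,\cdot)$ are equivalent for all $x,y\in\Omega$. *)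

(* Defs.v *)
From HB Require Import structures.
From mathcomp Require Import all_boot all_order all_algebra.
From mathcomp Require Import all_classical all_reals all_analysis.
Set Implicit Arguments. Unset Strict Implicit. Unset Printing Implicit Defensive.
Import Order.TTheory GRing.Theory Num.Theory.
Local Open Scope classical_set_scope.
Local Open Scope ring_scope.

Definition borel (T : topologicalType) := g_sigma_algebraType (@open T).

Definition tv_norm d (T : measurableType d) (R : realType)
    (m : set T -> \bar R) : \bar R :=
  ereal_sup [set (\sum_(A <- s) `|m A|)%E | s in
    [set s : seq (set T) |
      (forall A, A \in s -> measurable A) /\
      (forall i j, (i < size s)%N -> (j < size s)%N -> i != j ->
         nth set0 s i `&` nth set0 s j = set0) /\
      \big[setU/set0]_(A <- s) A = setT]].

(* The action of the operator with (probability) kernel k on a finite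
   signed measure nu = nu1 - nu2:  (T nu)(A) = \int k(x,A) d nu(x). *)
Definition kact d (T : measurableType d) (R : realType) (k : R.-pker T ~> T)
    (nu1 nu2 : {finite_measure set T -> \bar R}) (A : set T) : \bar R :=
  ((\int[nu1]_x k x A) - (\int[nu2]_x k x A))%E.

(* Main.v *)
Require Import Defs.
From HB Require Import structures.
From mathcomp Require Import all_boot all_order all_algebra.
From mathcomp Require Import all_classical all_reals all_analysis.
From mathcomp Require Import measurable_realfun lra.
Import Order.TTheory GRing.Theory Num.Theory.
Import numFieldNormedType.Exports.
Set Implicit Arguments.
Unset Strict Implicit.
Unset Printing Implicit Defensive.
Local Open Scope classical_set_scope.
Local Open Scope ring_scope.

(** Since [|T(t) nu - nu(Omega) mu|] is nonincreasing in [t], only the discrete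
    chain [P = k_{t0}] matters, and [t0]-regularity makes every [P(x, .)]
    equivalent to [mu].  Let [Phi_n] be the [mu]-essential supremum of the
    functions [P^n f - mu f] over measurable [0 <= f <= 1].  It decreases with
    [n] almost everywhere, and [psi_n := P Phi_n] dominates [|P^{n+1} f - mu f|]
    everywhere, in particular [Phi_{n+1} <= psi_n].  By invariance
    [mu psi_n = mu Phi_n], so that [psi_n(x) - Phi_{n+1}(x)] tends to [0] along
    a subsequence for some [x].  If [f_n] is almost optimal for
    [Phi_{n+1}(x)], the functions [Phi_n - (P^n f_n - mu f_n) >= 0] tend to [0]
    in [L^1(P(x, .))], hence, along a subsequence, in [L^1(mu)]; but their
    [mu]-integral is [mu Phi_n].  Thus [mu Phi_n] tends to [0], and
    [P(x, .) << mu] gives [psi_n(x) --> 0] for every [x]. *)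

(** * Bounded measurable functions and their real integrals over finite measures *)

Section bounded_measurable.
Context {d} {X : measurableType d} {R : realType}.
Implicit Types (f g : X -> R) (m : {measure set X -> \bar R}).

(** Such functions are integrable for every finite measure, so real-valued integrals can be added
    and compared with no further side condition. *)
Definition bmeas f := measurable_fun setT f /\ exists M, forall x, `|f x| <= M.

Lemma bmeas_le f M : measurable_fun setT f -> (forall x, `|f x| <= M) -> bmeas f.
Proof. by move=> mf fM; split=> //; exists M. Qed.

Lemma bmeas_cst (c : R) : bmeas (fun=> c).
Proof. by apply: (@bmeas_le _ `|c|) => //; exact: measurable_cst. Qed.

Lemma bmeasD f g : bmeas f -> bmeas g -> bmeas (fun x => f x + g x).
Proof.
move=> [mf [M fM]] [mg [N gN]]; apply: (@bmeas_le _ (M + N)).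
  exact: measurable_funD.
by move=> x; rewrite (le_trans (ler_normD _ _))// lerD.
Qed.

Lemma bmeasB f g : bmeas f -> bmeas g -> bmeas (fun x => f x - g x).
Proof.
move=> [mf [M fM]] [mg [N gN]]; apply: (@bmeas_le _ (M + N)).
  exact: measurable_funB.
by move=> x; rewrite (le_trans (ler_normB _ _))// lerD.
Qed.

Lemma bmeas_norm f : bmeas f -> bmeas (fun x => `|f x|).
Proof.
move=> [mf [M fM]]; apply: (@bmeas_le _ M); last by move=> x; rewrite normr_id.
exact: measurableT_comp.
Qed.

Lemma bmeas_max f g : bmeas f -> bmeas g -> bmeas (fun x => Num.max (f x) (g x)).
Proof.
move=> [mf [M fM]] [mg [N gN]]; apply: (@bmeas_le _ (Num.max M N)).
  exact: measurable_maxr.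
by move=> x; case: (leP (f x) (g x)) => _; rewrite le_max ?fM ?gN ?orbT.
Qed.

Lemma bmeas_integrable m f : (m setT < +oo)%E -> bmeas f ->
  m.-integrable setT (EFin \o f).
Proof.
move=> mT [mf [M fM]]; apply: measurable_bounded_integrable => //.
exists M; split; first exact: num_real.
by move=> N MN x _ /=; rewrite (le_trans (fM x))// ltW.
Qed.

Section finite.
Variable m : {measure set X -> \bar R}.
Hypothesis mT : (m setT < +oo)%E.

Lemma RintD f g : bmeas f -> bmeas g ->
  \int[m]_x (f x + g x) = \int[m]_x f x + \int[m]_x g x.
Proof. by move=> bf bg; apply: RintegralD => //; apply: bmeas_integrable. Qed.

Lemma RintB f g : bmeas f -> bmeas g ->
  \int[m]_x (f x - g x) = \int[m]_x f x - \int[m]_x g x.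
Proof. by move=> bf bg; apply: RintegralB => //; apply: bmeas_integrable. Qed.

Lemma le_Rint f g : bmeas f -> bmeas g -> (forall x, f x <= g x) ->
  \int[m]_x f x <= \int[m]_x g x.
Proof. by move=> bf bg fg; apply: le_Rintegral => //; apply: bmeas_integrable. Qed.

Lemma ae_eq_Rint f g : bmeas f -> bmeas g -> {ae m, forall x, f x = g x} ->
  \int[m]_x f x = \int[m]_x g x.
Proof.
move=> [mf _] [mg _] fg; congr fine; apply: ae_eq_integral => //.
- exact/measurable_EFinP.
- exact/measurable_EFinP.
- by apply: filterS fg => x fgx _; rewrite fgx.
Qed.

(** The maximum of [f] and [g] dominates [f] everywhere and agrees with [g] almost everywhere. *)
Lemma ae_le_Rint f g : bmeas f -> bmeas g -> {ae m, forall x, f x <= g x} ->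
  \int[m]_x f x <= \int[m]_x g x.
Proof.
move=> bf bg fg; have bfg := bmeas_max bf bg.
apply: (@le_trans _ _ (\int[m]_x Num.max (f x) (g x))).
  by apply: le_Rint => // x; rewrite le_max lexx.
rewrite (ae_eq_Rint bfg bg)//; apply: filterS fg => x fgx.
exact/max_idPr.
Qed.

(** The nonnegative function [g - f] has integral zero, hence vanishes almost everywhere. *)
Lemma Rint_ae_eq f g : bmeas f -> bmeas g -> (forall x, f x <= g x) ->
  \int[m]_x f x = \int[m]_x g x -> {ae m, forall x, f x = g x}.
Proof.
move=> bf bg fg eqfg; have bh := bmeasB bg bf.
have h0 : \int[m]_x (g x - f x) = 0 by rewrite RintB// eqfg subrr.
have ih := bmeas_integrable mT bh.
have : (\int[m]_x `|(EFin \o (fun x => g x - f x)%R) x|)%E = 0%E.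
  under eq_integral do rewrite /= ger0_norm ?subr_ge0//.
  have := congr1 EFin h0; rewrite /Rintegral fineK//.
  exact: integrable_fin_num.
have /integrableP[mh _] := ih.
move=> /(ae_eq_integral_abs m measurableT mh)[N [mN N0 hN]].
exists N; split=> //; apply: subset_trans hN; apply: subsetC => x /= /(_ I).
by move=> [] /eqP; rewrite subr_eq0 => /eqP.
Qed.

Lemma Rint_sum (I : Type) (s : seq I) (u : I -> X -> R) :
  (forall i, bmeas (u i)) ->
  bmeas (fun x => \sum_(i <- s) u i x) /\
  \int[m]_x (\sum_(i <- s) u i x) = \sum_(i <- s) \int[m]_x u i x.
Proof.
move=> bu; elim: s => [|i s [IHb IH]].
  under eq_fun do rewrite big_nil.
  by rewrite big_nil; split; [exact: bmeas_cst|rewrite Rintegral_cst// mul0r].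
under eq_fun do rewrite big_cons.
by rewrite big_cons -IH -RintD//; split; first exact: bmeasD.
Qed.

End finite.

Lemma ae_dominates m1 m2 (Q : set X) : m1 `<< m2 ->
  {ae m2, forall x, Q x} -> {ae m1, forall x, Q x}.
Proof.
move=> /null_content_dominatesP dom [N [mN N0 QN]].
by exists N; split=> //; exact: dom.
Qed.

Lemma ae_exists m (Q : set X) :
  (m setT != 0)%E -> {ae m, forall x, Q x} -> exists x, Q x.
Proof.
move=> mT [N [mN N0 QN]]; apply: contrapT => /forallNP nQ; case/eqP : mT.
by apply/eqP; rewrite -measure_le0 -N0 le_measure ?inE// => x _; exact/QN/nQ.
Qed.

Lemma integral0_exists m (g : X -> \bar R) :
  (m setT != 0)%E -> measurable_fun setT g -> (forall x, 0 <= g x)%E ->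
  (\int[m]_x g x = 0)%E -> exists x, g x = 0%E.
Proof.
move=> mT mg g0 ig; apply: (ae_exists mT).
have : (\int[m]_x `|g x| = 0)%E by under eq_integral do rewrite gee0_abs//.
by move=> /(ae_eq_integral_abs m measurableT mg); apply: filterS => x /(_ I).
Qed.

End bounded_measurable.

(** * Integration against probability kernels *)

Section kernel.
Context {d} {X : measurableType d} {R : realType}.
Variable k : R.-pker X ~> X.
Implicit Types (f g : X -> R).

Lemma pkerT_lty x : (k x setT < +oo)%E.
Proof. by rewrite prob_kernel ltey. Qed.

Lemma Rint_pker_cst x (c : R) : \int[k x]_y c = c.
Proof. by rewrite Rintegral_cst// prob_kernel/= mulr1. Qed.

Lemma Rint_pker_norm x f M : measurable_fun setT f -> (forall y, `|f y| <= M) ->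
  `|\int[k x]_y f y| <= M.
Proof.
move=> mf fM; have bf := bmeas_le mf fM; have kT := pkerT_lty x.
have fI y : - M <= f y <= M by rewrite -ler_norml.
rewrite ler_norml -{1}(Rint_pker_cst x (- M)) -{2}(Rint_pker_cst x M).
apply/andP; split; apply: le_Rint => //; try exact: bmeas_cst;
  by move=> y; case/andP : (fI y).
Qed.

Lemma bmeas_pker f : bmeas f -> bmeas (fun x => \int[k x]_y f y).
Proof.
move=> [mf [M fM]]; apply: (@bmeas_le _ _ _ _ M); last first.
  by move=> x; exact: Rint_pker_norm.
have bf := bmeas_le mf fM; have bM := bmeas_cst (X := X) M.
(* Adding the bound [M] makes the integrand nonnegative, where measurability of kernel integrals is
   available; the constant is subtracted again since [k x] has mass one. *)
rewrite (_ : (fun x => _) = (fun x => \int[k x]_y (f y + M) - M)).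
  apply: measurable_funB; last exact: measurable_cst.
  apply: measurableT_comp; first exact: fine_measurable.
  apply: measurable_fun_integral_kernel.
  - by move=> U mU; exact: measurable_kernel.
  - by move=> y; rewrite lee_fin -lerBlDr sub0r; case/ler_normlP: (fM y); lra.
  - by apply/measurable_EFinP; case: (bmeasD bf bM).
by apply/funext => x; rewrite RintD// ?Rint_pker_cst ?addrK// pkerT_lty.
Qed.

End kernel.

(** Extends the Chapman-Kolmogorov identity from sets to bounded functions. Keeping [m] an arbitrary
    measure lets the lemma serve both for transition kernels and for an invariant measure. *)
Lemma Rint_pker_comp d (X : measurableType d) (R : realType)
    (k l : R.-pker X ~> X) x (m : {measure set X -> \bar R})
    (f : X -> R) :
  (forall A, measurable A -> m A = \int[l x]_y k y A)%E -> bmeas f ->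
  \int[m]_y f y = \int[l x]_y \int[k y]_z f z.
Proof.
move=> mE bf.
have mT : (m setT < +oo)%E.
  rewrite mE//; under eq_integral do rewrite prob_kernel.
  by rewrite integral_cst// prob_kernel mule1 ltey.
have m1 c : \int[m]_y c = c.
  rewrite Rintegral_cst// mE//; under eq_integral do rewrite prob_kernel.
  by rewrite integral_cst// prob_kernel mule1 mulr1.
have [mf [M fM]] := bf; have bM := bmeas_cst (X := X) M.
have fM0 z : 0 <= f z + M by case/ler_normlP: (fM z); lra.
(* Reduction to a nonnegative integrand; all measures involved have mass one, so the shift by [M]
   cancels on both sides. *)
suff : \int[m]_y (f y + M) = \int[l x]_y \int[k y]_z (f z + M).
  rewrite RintD// m1.
  under [RHS]eq_Rintegral do rewrite RintD// ?pkerT_lty// Rint_pker_cst.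
  rewrite RintD// ?pkerT_lty//; last exact: bmeas_pker.
  by rewrite Rint_pker_cst => /addIr.
have [mfM _] := bmeasD bf bM.
rewrite /Rintegral; congr fine.
rewrite (eq_measure_integral (kcomp l (kernel.kernel_snd k) x)); last first.
  by move=> A mA _; rewrite mE.
have mfE : measurable_fun setT (fun z => (f z + M)%:E) by exact/measurable_EFinP.
rewrite integral_kcomp//.
apply: eq_integral => y _; rewrite fineK//.
apply: integrable_fin_num => //; apply: bmeas_integrable; first exact: pkerT_lty.
exact: bmeasD.
Qed.

(** * Dominated convergence and almost everywhere convergent subsequences *)

Section sequences.
Context {d} {X : measurableType d} {R : realType}.
Variable m : {measure set X -> \bar R}.
Hypothesis mT : (m setT < +oo)%E.

Lemma Rint_cvg0 (h : nat -> X -> R) (C : R) :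
  (forall n, measurable_fun setT (h n)) -> (forall n x, `|h n x| <= C) ->
  {ae m, forall x, h n x @[n --> \oo] --> 0} ->
  \int[m]_x h n x @[n --> \oo] --> 0.
Proof.
move=> mh hC h0.
have [] := @dominated_convergence _ X R m setT measurableT
  (fun n => EFin \o h n) (cst 0%E) (cst C%:E).
- by move=> n; exact/measurable_EFinP.
- exact: measurable_cst.
- by apply: filterS h0 => x hx _; apply: cvg_EFin => //; exact: nearW.
- exact: (bmeas_integrable mT (bmeas_cst C)).
- by apply: aeW => x n _; rewrite lee_fin.
by move=> _ _; rewrite integral0 => /fine_cvg.
Qed.

(** Indices with summable integrals give an integrable series, which is finite almost everywhere, so
    its terms tend to zero. The selection [s] is not claimed to be increasing: its uses only need
    indices at which a quantity is small. *)
Lemma ae_cvg0_subseq (h : nat -> X -> R) : (forall n, bmeas (h n)) ->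
  (forall n, {ae m, forall x, 0 <= h n x}) ->
  \int[m]_x h n x @[n --> \oo] --> 0 ->
  exists s : nat -> nat, {ae m, forall x, h (s j) x @[j --> \oo] --> 0}.
Proof.
move=> bh h0 /cvgrPdist_le hcvg.
(* The bounds [1 / 2 ^ j.+1] sum to one. *)
have hs j : exists n, \int[m]_x h n x <= 1 / (2 ^ j.+1)%:R.
  have /hcvg[n _ /(_ n (leqnn n))] : 0 < 1 / (2 ^ j.+1)%:R :> R.
    by rewrite divr_gt0// ltr0n expn_gt0.
  by rewrite sub0r normrN => /(le_trans (ler_norm _)); exists n.
have [s sP] := choice hs; exists s.
(* Truncation at zero gives nonnegativity everywhere, as needed to exchange sum and integral, and
   changes [h (s j)] only on a null set. *)
pose H j x := Num.max (h (s j) x) 0.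
have bH j : bmeas (H j) by apply: bmeas_max => //; exact: bmeas_cst.
have H0 j x : 0 <= H j x by rewrite le_max lexx orbT.
have mH j : measurable_fun setT (EFin \o H j).
  by apply/measurable_EFinP; case: (bH j).
have HE : {ae m, forall x, forall j, H j x = h (s j) x}.
  by apply: ae_foralln => j; apply: filterS (h0 (s j)) => x; exact: max_l.
have iH j : (\int[m]_x (H j x)%:E <= (1 / (2 ^ j.+1)%:R)%:E)%E.
  rewrite -[leLHS]fineK; last first.
    by apply: integrable_fin_num => //; exact: bmeas_integrable.
  rewrite lee_fin (le_trans _ (sP j))// le_eqVlt; apply/orP; left; apply/eqP.
  by apply: ae_eq_Rint => //; apply: filterS HE => x.
have Sfin : (\int[m]_x (\sum_(j <oo) (H j x)%:E) < +oo)%E.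
  rewrite integral_nneseries//; last by move=> n x _; rewrite lee_fin.
  apply: (@le_lt_trans _ _ (1%:E)); last exact: ltey.
  apply: le_trans (epsilon_trick0 xpredT (ler01)).
  apply: lee_nneseries => [j _ _|j _]; last exact: iH.
  by apply: integral_ge0 => x _; rewrite lee_fin.
have mS : measurable_fun setT (fun x => \sum_(j <oo) (H j x)%:E)%E.
  apply: ge0_emeasurable_sum => [j x _ _|j _]; last exact: mH.
  by rewrite lee_fin.
have S0 x : (0 <= \sum_(j <oo) (H j x)%:E)%E.
  by apply: nneseries_ge0 => j _ _; rewrite lee_fin.
have Sint : m.-integrable setT (fun x => \sum_(j <oo) (H j x)%:E)%E.
  apply/integrableP; split=> //.
  by under eq_integral do rewrite gee0_abs//.
have := integrable_ae measurableT Sint.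
apply: filterS2 HE => x HEx /(_ I) Sx.
rewrite (_ : (fun j => _) = H ^~ x); last by apply/funext => j; rewrite HEx.
apply: cvg_series_cvg_0; apply: nondecreasing_is_cvgn.
  by apply/nondecreasing_seqP => n; rewrite seriesSr/= lerDl.
exists (fine (\sum_(j <oo) (H j x)%:E)%E) => _ [n _ <-].
rewrite -lee_fin fineK// /series/= -sumEFin.
by apply: nneseries_lim_ge => j _ _; rewrite lee_fin.
Qed.

End sequences.

(** Convergence in [L^1(m2)] is almost everywhere convergence along a selection of indices; null
    sets of [m2] are null for [m1], and dominated convergence applies there. Without a density bound
    this transfers smallness to some index, which suffices for monotone quantities. *)
Lemma dominates_Rint_small d (X : measurableType d) (R : realType)
    (m1 m2 : {measure set X -> \bar R}) (h : nat -> X -> R) (C : R) :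
  (m1 setT < +oo)%E -> (m2 setT < +oo)%E -> m1 `<< m2 ->
  (forall n, measurable_fun setT (h n)) -> (forall n x, `|h n x| <= C) ->
  (forall n, {ae m2, forall x, 0 <= h n x}) ->
  \int[m2]_x h n x @[n --> \oo] --> 0 ->
  forall e, 0 < e -> exists n, \int[m1]_x h n x < e.
Proof.
move=> m1T m2T m12 mh hC h0 hcvg e e0.
have [n|s hs] := ae_cvg0_subseq m2T _ h0 hcvg; first exact: bmeas_le (mh n) (hC n).
have /cvgrPdist_lt/(_ _ e0)[n _ /(_ n (leqnn n))] : \int[m1]_x h (s n) x @[n --> \oo] --> 0.
  by apply: (Rint_cvg0 m1T (C := C)) => //; exact: ae_dominates hs.
by rewrite sub0r normrN => /(le_lt_trans (ler_norm _)); exists (s n).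
Qed.

(** * Essential suprema as pointwise suprema of countable subfamilies *)

Section essential_supremum.
Context {d} {X : measurableType d} {R : realType}.
Implicit Types (g : nat -> X -> R).

Definition supf g x := sup (range (g ^~ x)).

Section supf.
Variables (g : nat -> X -> R) (C : R).
Hypothesis mg : forall n, measurable_fun setT (g n).
Hypothesis gC : forall n x, `|g n x| <= C.

Lemma supf_has_sup x : has_sup (range (g ^~ x)).
Proof.
split; first by exists (g 0%N x), 0%N.
by exists C => _ [n _ <-]; exact: le_trans (ler_norm _) (gC _ _).
Qed.

Lemma supf_ub n x : g n x <= supf g x.
Proof. by apply: ub_le_sup; [case: (supf_has_sup x)|exists n]. Qed.

Lemma supf_le x r : (forall n, g n x <= r) -> supf g x <= r.
Proof.
by move=> gr; apply: ge_sup; [case: (supf_has_sup x)|move=> _ [n _ <-]].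
Qed.

Lemma supf_norm x : `|supf g x| <= C.
Proof.
rewrite ler_norml (le_trans _ (supf_ub 0 x))/=; last first.
  by have /ler_normlP[] := gC 0 x; lra.
by apply: supf_le => n; exact: le_trans (ler_norm _) (gC _ _).
Qed.

Lemma measurable_supf : measurable_fun setT (supf g).
Proof.
have := @measurable_fun_sups _ X R setT g 0.
rewrite (_ : (fun x => _) = supf g); last first.
  apply/funext => x; rewrite /supf /sups; congr sup.
  by apply/seteqP; split=> [_ [n _ <-]|_ [n _ <-]]; exists n.
by apply=> // x _; case: (supf_has_sup x).
Qed.

Lemma bmeas_supf : bmeas (supf g).
Proof. exact: bmeas_le measurable_supf supf_norm. Qed.

End supf.

(* A countable subfamily whose supremum has maximal integral does the job. *)
Lemma essential_supremum (m : {measure set X -> \bar R}) (F : set (X -> R))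
    (C : R) :
  (m setT < +oo)%E -> F !=set0 ->
  (forall f, F f -> measurable_fun setT f /\ forall x, `|f x| <= C) ->
  exists g, (forall n, F (g n)) /\
    forall f, F f -> {ae m, forall x, f x <= supf g x}.
Proof.
move=> mT [f0 Ff0] FC.
pose I := [set \int[m]_x supf g x | g in [set g | forall n, F (g n)]].
have mF g : (forall n, F (g n)) -> forall n, measurable_fun setT (g n).
  by move=> gF n; case: (FC _ (gF n)).
have bF g : (forall n, F (g n)) -> forall n x, `|g n x| <= C.
  by move=> gF n; case: (FC _ (gF n)).
have bs g : (forall n, F (g n)) -> bmeas (supf g).
  by move=> gF; exact: bmeas_supf (mF _ gF) (bF _ gF).
have supI : has_sup I.
  split; first by exists (\int[m]_x supf (fun=> f0) x), (fun=> f0).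
  exists (\int[m]_x C) => _ [g gF <-].
  apply: le_Rint => //; [exact: bs|exact: bmeas_cst|move=> x].
  exact: le_trans (ler_norm _) (supf_norm (bF _ gF) x).
have pickg i : exists g, (forall n, F (g n)) /\
    sup I - i.+1%:R^-1 < \int[m]_x supf g x.
  have [|_ [g gF <-] lt] := sup_adherent (eps := i.+1%:R^-1) _ supI.
    by rewrite invr_gt0.
  by exists g.
have [gg ggP] := choice pickg.
(* One sequence runs through all [gg i j] by the coding of pairs; [f0] fills the indices that code
   no pair. Hence [supf G] dominates every [supf (gg i)]. *)
pose G n := if @unpickle (nat * nat)%type n is Some ij then gg ij.1 ij.2 else f0.
have GF n : F (G n) by rewrite /G; case: unpickle => // ij; case: (ggP ij.1).
have GI : sup I <= \int[m]_x supf G x.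
  rewrite leNgt; apply/negP => lt.
  have e0 : 0 < sup I - \int[m]_x supf G x by rewrite subr_gt0.
  have [i _ /(_ i (leqnn i))/= iG] := near_infty_natSinv_lt (PosNum e0).
  have [gF gI] := ggP i.
  have : \int[m]_x supf (gg i) x <= \int[m]_x supf G x.
    apply: le_Rint; [by []|exact: bs|exact: bs|move=> x].
    apply: (supf_le (bF _ gF)) => j.
    by have := supf_ub (bF _ GF) (pickle (i, j)) x; rewrite {1}/G pickleK.
  rewrite leNgt => /negP; apply; apply: lt_trans gI.
  by rewrite ltrBrDl addrC -ltrBrDl in iG *.
exists G; split=> // f Ff.
(* Prepending [f] can only raise the supremum, yet its integral is already maximal, so the two
   suprema agree almost everywhere. *)
pose G' n := if n is n'.+1 then G n' else f.
have GF' n : F (G' n) by case: n => /=.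
have GG' x : supf G x <= supf G' x.
  by apply: (supf_le (bF _ GF)) => n; exact: (supf_ub (bF _ GF') n.+1).
have : {ae m, forall x, supf G x = supf G' x}.
  apply: Rint_ae_eq => //; [exact: bs|exact: bs|apply/eqP].
  rewrite eq_le le_Rint//=; [|exact: bs|exact: bs].
  apply: le_trans GI; apply: ub_le_sup; first by case: supI.
  by exists G'.
by apply: filterS => x ->; exact: (supf_ub (bF _ GF') 0).
Qed.

End essential_supremum.

(** * Real sequences and the invariant integral *)

Lemma nonincreasing_cvg0 (R : realType) (u : nat -> R) :
  (forall n, u n.+1 <= u n) -> (forall n, 0 <= u n) ->
  (forall e, 0 < e -> exists n, u n < e) -> u n @[n --> \oo] --> 0.
Proof.
move=> /nonincreasing_seqP uS u0 u_small.
apply/cvgrPdist_lt => e /u_small[n une]; exists n => // p /= np.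
by rewrite sub0r normrN ger0_norm// (le_lt_trans (uS _ _ np)).
Qed.

Lemma cvg_diffS (R : realType) (u : nat -> R) :
  cvgn u -> u n - u n.+1 @[n --> \oo] --> 0.
Proof.
move=> cu; rewrite -(subrr (limn u)); apply: cvgB => //.
by rewrite (cvg_shiftS u).
Qed.

Lemma Rint_invariant d (X : measurableType d) (R : realType)
    (k : R.-pker X ~> X) (mu : probability X R) (f : X -> R) :
  (forall A, measurable A -> \int[mu]_x k x A = mu A)%E -> bmeas f ->
  \int[mu]_x \int[k x]_y f y = \int[mu]_x f x.
Proof.
(* Viewing [mu] as the value of a constant kernel turns invariance into an instance of kernel
   composition; the base point is arbitrary. *)
move=> inv bf; pose P : X -> pprobability X R := cst mu.
have mP : measurable_fun setT P by exact: measurable_cst.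
by rewrite (@Rint_pker_comp _ _ _ k (kprobability mP) point mu f)// => A /inv.
Qed.

(** * Convergence of the discrete chain *)

Section doob.
Context {d} {X : measurableType d} {R : realType}.
Variables (P : nat -> R.-pker X ~> X) (mu : probability X R).
Hypothesis Pn1 : forall n x A, measurable A ->
  (P n.+1 x A = \int[P n x]_y P 1%N y A)%E.
Hypothesis P1n : forall n x A, measurable A ->
  (P n.+1 x A = \int[P 1%N x]_y P n y A)%E.
Hypothesis Pmu : forall n A, measurable A -> (\int[mu]_x P n x A = mu A)%E.
Hypothesis mu_dom : forall x, mu `<< P 1%N x.
Hypothesis dom_mu : forall x, P 1%N x `<< mu.

(** This class is stable under kernels and under [f] to [1 - f], and contains the functions [x] to
    [k x A]. It is therefore large enough to control the kernels at all later times. *)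
Definition test (f : X -> R) :=
  measurable_fun setT f /\ forall x, 0 <= f x <= 1.

Lemma test_norm f : test f -> forall x, `|f x| <= 1.
Proof. by move=> [_ f01] x; have /andP[f0 f1] := f01 x; rewrite ger0_norm. Qed.

Lemma test_bmeas f : test f -> bmeas f.
Proof. by move=> tf; apply: (bmeas_le _ (test_norm tf)); case: tf. Qed.

Lemma test0 : test (cst 0).
Proof. by split=> [|x]; [exact: measurable_cst|rewrite lexx ler01]. Qed.

Lemma testC f : test f -> test (fun x => 1 - f x).
Proof.
move=> [mf f01]; split=> [|x]; last by have := f01 x; lra.
by apply: measurable_funB => //; exact: measurable_cst.
Qed.

Lemma test_pker (k : R.-pker X ~> X) f : test f -> test (fun x => \int[k x]_y f y).
Proof.
move=> tf; have bf := test_bmeas tf; split=> [|x]; first by case: (bmeas_pker k bf).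
case: (tf) => _ f01; apply/andP; split.
  by apply: Rintegral_ge0 => y _; case/andP : (f01 y).
rewrite -[leRHS](Rint_pker_cst k x); apply: le_Rint => //; first exact: pkerT_lty.
  exact: bmeas_cst.
by move=> y; case/andP : (f01 y).
Qed.

Definition dev n f x := \int[P n x]_y f y - \int[mu]_y f y.

Let muT : (mu setT < +oo)%E. Proof. by rewrite probability_setT ltey. Qed.

Let Rint_mu_cst (c : R) : \int[mu]_x c = c.
Proof. by rewrite Rintegral_cst//= probability_setT mulr1. Qed.

Lemma test_mu f : test f -> 0 <= \int[mu]_y f y <= 1.
Proof.
move=> tf; case: (tf) => _ f01; apply/andP; split.
  by apply: Rintegral_ge0 => y _; case/andP : (f01 y).
rewrite -[leRHS]Rint_mu_cst; apply: le_Rint => //; first exact: test_bmeas.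
  exact: bmeas_cst.
by move=> y; case/andP : (f01 y).
Qed.

Lemma measurable_dev n f : test f -> measurable_fun setT (dev n f).
Proof.
by move=> tf; apply: measurable_funB; [case: (test_pker (P n) tf)|exact: measurable_cst].
Qed.

Lemma dev_norm n f x : test f -> `|dev n f x| <= 1.
Proof.
move=> tf; have [_ /(_ x)] := test_pker (P n) tf; have := test_mu tf.
by rewrite /dev ler_norml; lra.
Qed.

Lemma bmeas_dev n f : test f -> bmeas (dev n f).
Proof.
by move=> tf; apply: (bmeas_le (measurable_dev n tf)) => x; exact: dev_norm.
Qed.

(** This reflection turns a one-sided bound valid for all tests into a bound on the absolute
    value. *)
Lemma devC n f x : test f -> dev n (fun y => 1 - f y) x = - dev n f x.
Proof.
move=> tf; have bf := test_bmeas tf; have b1 := bmeas_cst (X := X) (1 : R).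
by rewrite /dev !RintB// ?pkerT_lty// Rint_pker_cst Rint_mu_cst; lra.
Qed.

Lemma Rint_mu_dev n f : test f -> \int[mu]_x dev n f x = 0.
Proof.
move=> tf; have bf := test_bmeas tf.
rewrite RintB//; [|exact: bmeas_pker|exact: bmeas_cst].
by rewrite Rint_mu_cst Rint_invariant ?subrr// => A; exact: Pmu.
Qed.

(** Here the last step of the chain is absorbed into the test function, which makes the essential
    suprema decrease with [n]. *)
Lemma dev_pker n f x : test f ->
  dev n.+1 f x = dev n (fun y => \int[P 1%N y]_z f z) x.
Proof.
move=> tf; have bf := test_bmeas tf.
rewrite /dev (Rint_invariant (Pmu 1))//; congr (_ - _).
by apply: Rint_pker_comp => // A; exact: Pn1.
Qed.

(** Here the first step is split off instead, so that a bound on [dev n] valid only [mu]-almost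
    everywhere becomes, after integration, a bound on [dev n.+1] at every point. *)
Lemma Rint_dev n f x : test f -> \int[P 1%N x]_y dev n f y = dev n.+1 f x.
Proof.
move=> tf; have bf := test_bmeas tf.
rewrite RintB ?pkerT_lty//; [|exact: bmeas_pker|exact: bmeas_cst].
rewrite Rint_pker_cst; congr (_ - _); apply/esym.
by apply: Rint_pker_comp => // A; exact: P1n.
Qed.

(** The bound is a single measurable function of [x], uniform over tests, so that it can later be
    integrated against any finite measure. *)
Lemma doob_discrete : exists psi : nat -> X -> R,
  [/\ forall n, measurable_fun setT (psi n),
      forall n x, `|psi n x| <= 1,
      forall x, psi n x @[n --> \oo] --> 0 &
      forall n f x, test f -> `|dev n.+1 f x| <= psi n x].
Proof.
(* For each [n], countably many tests [F n j] realise the essential supremum of all deviations at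
   time [n]. *)
have /choice[F FP] n : exists F : nat -> X -> R, (forall j, test (F j)) /\
    forall f, test f ->
      {ae mu, forall x, dev n f x <= supf (fun j => dev n (F j)) x}.
  have [|_ [f tf <-]|g [gF gsup]] := @essential_supremum _ _ _ mu
    [set dev n f | f in test] 1 muT.
  - by exists (dev n (cst 0)), (cst 0) => //; exact: test0.
  - by split=> [|x]; [exact: measurable_dev|exact: dev_norm].
  have /choice[F FP] j : exists f, test f /\ dev n f = g j.
    by have [f tf <-] := gF j; exists f.
  exists F; split=> [j|f tf]; first by have [] := FP j.
  have -> : (fun j => dev n (F j)) = g by apply/funext => j; have [] := FP j.
  by apply: gsup; exists f.
pose Phi n := supf (fun j => dev n (F n j)).
have tF n j : test (F n j) by have [] := FP n.
have FPhi n f : test f -> {ae mu, forall x, dev n f x <= Phi n x}.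
  by have [_] := FP n; apply.
have devF n j x : `|dev n (F n j) x| <= 1 by exact: dev_norm.
have mPhi n : measurable_fun setT (Phi n).
  by apply: (measurable_supf (C := 1)) => // j; exact: measurable_dev.
have Phi1 n x : `|Phi n x| <= 1 by exact: supf_norm.
have bPhi n : bmeas (Phi n) by exact: bmeas_le (mPhi n) (Phi1 n).
have PhiS n : {ae mu, forall x, Phi n.+1 x <= Phi n x}.
  have : {ae mu, forall x, forall j, dev n.+1 (F n.+1 j) x <= Phi n x}.
    apply: ae_foralln => j.
    apply: filterS (FPhi n _ (test_pker (P 1%N) (tF n.+1 j))) => x.
    by rewrite dev_pker.
  by apply: filterS => x; exact: supf_le.
have Phi0 n : {ae mu, forall x, 0 <= Phi n x}.
  apply: filterS (FPhi n _ test0) => x; apply: le_trans.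
  by rewrite /dev Rint_pker_cst Rint_mu_cst subrr.
pose psi n x := \int[P 1%N x]_y Phi n y.
have bpsi n : bmeas (psi n) by exact: bmeas_pker.
have P1T x : (P 1%N x setT < +oo)%E by exact: pkerT_lty.
have dev_psi n f x : test f -> dev n.+1 f x <= psi n x.
  move=> tf; rewrite -Rint_dev//; apply: ae_le_Rint => //.
    exact: bmeas_dev.
  exact: ae_dominates (dom_mu x) (FPhi n f tf).
have Phi_psi n x : Phi n.+1 x <= psi n x.
  by apply: (supf_le (C := 1)) => // j; exact: dev_psi.
have psiS n x : psi n.+1 x <= psi n x.
  by apply: ae_le_Rint => //; exact: ae_dominates (dom_mu x) (PhiS n).
have psi_abs n f x : test f -> `|dev n.+1 f x| <= psi n x.
  move=> tf; rewrite ler_norml dev_psi// andbT lerNl -devC// dev_psi//.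
  exact: testC.
pose a n := \int[mu]_x Phi n x.
have aS n : a n.+1 <= a n by exact: ae_le_Rint.
have a0 n : 0 <= a n.
  by rewrite -(Rint_mu_cst 0); apply: ae_le_Rint => //; exact: bmeas_cst.
have psi_a n : \int[mu]_x psi n x = a n by exact: Rint_invariant (Pmu 1) (bPhi n).
have acvg : cvgn a.
  apply: nonincreasing_is_cvgn; first exact/nonincreasing_seqP.
  by exists 0 => _ [n _ <-].
(* the defect of [Phi n.+1 <= psi n] has integral [a n - a n.+1], as [mu] is invariant *)
have [s /= gap] : exists s : nat -> nat,
    {ae mu, forall x, psi (s j) x - Phi (s j).+1 x @[j --> \oo] --> 0}.
  apply: (ae_cvg0_subseq muT (h := fun n x => psi n x - Phi n.+1 x)).
  - by move=> n; exact: bmeasB.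
  - by move=> n; apply: aeW => x; rewrite subr_ge0.
  - have -> : (fun n => \int[mu]_x (psi n x - Phi n.+1 x)) = (fun n => a n - a n.+1).
      by apply/funext => n; rewrite RintB// psi_a.
    exact: cvg_diffS.
have [x gapx] : exists x, psi (s j) x - Phi (s j).+1 x @[j --> \oo] --> 0.
  by apply: ae_exists gap; rewrite /= probability_setT eqe oner_eq0.
(* At the fixed point [x], [Phi (s j).+1 x] is a genuine supremum over a countable family, so some
   member comes within [1 / j.+1] of it. *)
have /choice[J JP] j : exists i,
    Phi (s j).+1 x - j.+1%:R^-1 < dev (s j).+1 (F (s j).+1 i) x.
  have [|_ [i _ <-] lt] := sup_adherent (eps := j.+1%:R^-1) _
    (supf_has_sup (fun i y => devF (s j).+1 i y) x).
    by rewrite invr_gt0.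
  by exists i.
pose f j := F (s j).+1 (J j).
have tf j : test (f j) by exact: tF.
pose h j y := Phi (s j) y - dev (s j) (f j) y.
(* The integrals of [h j] over [P 1 x] tend to zero, and [mu] is dominated by [P 1 x], so smallness
   passes to [mu]. *)
have h_small e : 0 < e -> exists j, \int[mu]_y h j y < e.
  apply: (@dominates_Rint_small _ _ _ mu (P 1%N x) h 2) => //.
  - by move=> j; apply: measurable_funB => //; exact: measurable_dev.
  - move=> j y; rewrite (le_trans (ler_normB _ _))//.
    by have := Phi1 (s j) y; have := dev_norm (s j) y (tf j); lra.
  - move=> j; apply: ae_dominates (dom_mu x) _.
    by apply: filterS (FPhi (s j) _ (tf j)) => y; rewrite subr_ge0.
  have hE j : \int[P 1%N x]_y h j y = psi (s j) x - dev (s j).+1 (f j) x.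
    by rewrite RintB// ?Rint_dev//; exact: bmeas_dev.
  have -> : (fun j => \int[P 1%N x]_y h j y) =
      (fun j => psi (s j) x - dev (s j).+1 (f j) x) by apply/funext.
  (* The integral lies between zero and the gap at [x] plus the optimality error of [f j]. *)
  apply: (@squeeze_cvgr _ _ _ _ (cst 0)
    (fun j => psi (s j) x - Phi (s j).+1 x + j.+1%:R^-1)).
  - apply: nearW => j; rewrite subr_ge0 dev_psi//=.
    by have := JP j; rewrite -/(f j); move: (_^-1) => r; lra.
  - exact: cvg_cst.
  - by have := cvgD gapx (@cvg_harmonic R); rewrite addr0; apply.
(* Deviations have [mu]-integral zero, so the [mu]-integral of [h j] is [a (s j)]. *)
have a_small e : 0 < e -> exists n, a n < e.
  move=> /h_small[j]; rewrite RintB//; last exact: bmeas_dev.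
  by rewrite Rint_mu_dev// subr0; exists (s j).
have a_cvg0 : a n @[n --> \oo] --> 0.
  exact: nonincreasing_cvg0.
have psi1 n y : `|psi n y| <= 1 by exact: Rint_pker_norm.
exists psi; split=> //; first by move=> n; case: (bpsi n).
(* [psi] decreases at every [y], so one small value suffices; it comes from [a] tending to zero, as
   [P 1 y] is dominated by [mu]. *)
move=> y; apply: nonincreasing_cvg0 => //.
  by move=> n; exact: le_trans (normr_ge0 _) (psi_abs n _ y test0).
exact: (@dominates_Rint_small _ _ _ (P 1%N y) mu Phi 1).
Qed.

End doob.

(** * Differences of measures summed over finite disjoint families *)

Section finite_partitions.
Context {d} {X : measurableType d} {R : realType}.
Implicit Types (p q : {measure set X -> \bar R}) (s : seq (set X)).

(** Disjointness is by position, as in [tv_norm], so only the empty set may occur twice. *)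
Definition pairwise_disjoint s := forall i j, (i < size s)%N -> (j < size s)%N ->
  i != j -> nth set0 s i `&` nth set0 s j = set0.

Lemma pairwise_disjoint_cons A s : pairwise_disjoint (A :: s) ->
  pairwise_disjoint s /\ forall B, B \in s -> A `&` B = set0.
Proof.
move=> dAs; split=> [i j si sj ij|B /(nthP set0)[i si <-]].
  exact: (dAs i.+1 j.+1).
exact: (dAs 0%N i.+1).
Qed.

Lemma measurable_bigsetU_seq s (Q : pred (set X)) :
  (forall A, A \in s -> measurable A) ->
  measurable (\big[setU/set0]_(A <- s | Q A) A).
Proof.
move=> ms; rewrite big_seq_cond.
by apply: big_ind => //; [exact: measurableU|move=> A /andP[/ms]].
Qed.

Lemma measure_bigsetU_seq p s (Q : pred (set X)) : fin_num_fun p ->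
  (forall A, A \in s -> measurable A) -> pairwise_disjoint s ->
  fine (p (\big[setU/set0]_(A <- s | Q A) A)) = \sum_(A <- s | Q A) fine (p A).
Proof.
move=> pfin; elim: s => [|A s IH] ms ds; first by rewrite !big_nil measure0.
have mA : measurable A by apply: ms; rewrite mem_head.
have {}ms B : B \in s -> measurable B by move=> sB; apply: ms; rewrite inE sB orbT.
have [{}ds dA] := pairwise_disjoint_cons ds.
rewrite !big_cons; case: ifPn => _; last exact: IH.
have mU := measurable_bigsetU_seq Q ms.
rewrite measureU//.
  by rewrite fineD ?pfin// IH.
rewrite big_seq_cond; apply: (big_ind (fun Z => A `&` Z = set0)).
- exact: setI0.
- by move=> Y Z AY AZ; rewrite setIUr AY AZ setU0.
- by move=> B /andP[/dA].
Qed.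

(** Grouping the sets by the sign of the difference, the sum over each group is, up to sign, the
    difference at one measurable union; the two groups give the factor 2. *)
Lemma sum_norm_measureB_le p q s c : fin_num_fun p -> fin_num_fun q ->
  (forall A, A \in s -> measurable A) -> pairwise_disjoint s ->
  (forall A, measurable A -> `|fine (p A) - fine (q A)| <= c) ->
  \sum_(A <- s) `|fine (p A) - fine (q A)| <= 2 * c.
Proof.
move=> pfin qfin ms ds pqc; pose Q (A : set X) := 0 <= fine (p A) - fine (q A).
rewrite (bigID Q)/= mulr2n mulrDl mul1r; apply: lerD.
  rewrite (eq_bigr (fun A => fine (p A) - fine (q A))); last first.
    by move=> A; exact: ger0_norm.
  rewrite big_split/= sumrN -!measure_bigsetU_seq//.
  by apply: le_trans (ler_norm _) (pqc _ _); exact: measurable_bigsetU_seq.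
rewrite (eq_bigr (fun A => - (fine (p A) - fine (q A)))); last first.
  by move=> A; rewrite -ltNge => /ltr0_norm.
rewrite sumrN big_split/= sumrN -!measure_bigsetU_seq//.
rewrite (le_trans (ler_norm _))// normrN.
by apply: pqc; exact: measurable_bigsetU_seq.
Qed.

End finite_partitions.

(** * Kernels evaluated at a fixed set *)

Section kernel_of_set.
Context {d} {X : measurableType d} {R : realType}.
Variable k : R.-pker X ~> X.

Lemma pker_fin_num x A : measurable A -> k x A \is a fin_num.
Proof. exact: finite_kernel_measure. Qed.

Lemma test_fine_pker A : measurable A -> test (fun x => fine (k x A)).
Proof.
move=> mA; split=> [|x].
  by apply: measurableT_comp; [exact: fine_measurable|exact: measurable_kernel].
have kA := pker_fin_num x mA.
rewrite -!lee_fin fineK// measure_ge0/= -(prob_kernel (s := k) x).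
by rewrite le_measure ?inE.
Qed.

Lemma integral_pkerE (m : {measure set X -> \bar R}) A : (m setT < +oo)%E ->
  measurable A -> (\int[m]_x k x A = (\int[m]_x fine (k x A))%R%:E)%E.
Proof.
move=> mT mA; rewrite fineK.
  by apply: eq_integral => x _; rewrite fineK// pker_fin_num.
apply: integrable_fin_num => //; apply: bmeas_integrable => //.
exact/test_bmeas/test_fine_pker.
Qed.

End kernel_of_set.

(** * Total variation bounds from a pointwise bound on the kernel *)

Section total_variation.
Context {d} {X : measurableType d} {R : realType}.
Variables (k : R.-pker X ~> X) (mu : probability X R).

Lemma bmeas_pkerB (A : set X) : measurable A ->
  bmeas (fun x => fine (k x A) - fine (mu A)).
Proof.
move=> mA; apply: bmeasB; last exact: bmeas_cst.
exact/test_bmeas/test_fine_pker.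
Qed.

Lemma Rint_pkerB (nu : {finite_measure set X -> \bar R}) (A : set X) :
  measurable A ->
  (\int[nu]_x k x A - nu setT * mu A)%E =
  (\int[nu]_x (fine (k x A) - fine (mu A)))%R%:E.
Proof.
move=> mA; have nuT : (nu setT < +oo)%E by rewrite ltey_eq fin_num_measure.
rewrite RintB//; [|exact/test_bmeas/test_fine_pker|exact: bmeas_cst].
have muA : mu A \is a fin_num by exact: fin_num_measure.
have nuTf : nu setT \is a fin_num by exact: fin_num_measure.
by rewrite integral_pkerE// Rintegral_cst// EFinB EFinM (fineK muA) (fineK nuTf) muleC.
Qed.

Lemma kactB (nu1 nu2 : {finite_measure set X -> \bar R}) (A : set X) :
  measurable A ->
  (kact k nu1 nu2 A - (nu1 setT - nu2 setT) * mu A)%E =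
  (\int[nu1]_x (fine (k x A) - fine (mu A)) -
   \int[nu2]_x (fine (k x A) - fine (mu A)))%R%:E.
Proof.
move=> mA; rewrite EFinB -!Rint_pkerB// /kact.
have nuT (nu : {finite_measure set X -> \bar R}) : (nu setT < +oo)%E.
  by rewrite ltey_eq fin_num_measure.
rewrite (integral_pkerE k (nuT nu1) mA) (integral_pkerE k (nuT nu2) mA).
have : nu2 setT \is a fin_num by exact: fin_num_measure.
have : nu1 setT \is a fin_num by exact: fin_num_measure.
have : mu A \is a fin_num by exact: fin_num_measure.
move: (nu1 setT) (nu2 setT) (mu A) => [a| |] [b| |] [c| |]// _ _ _.
by rewrite -!(EFinB, EFinM); congr EFin; lra.
Qed.

(** For a fixed partition the absolute values move inside the integrals; the sum over cells is then
    at most [2 * psi x] at each [x]. *)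
Lemma tv_norm_kactB_le (nu1 nu2 : {finite_measure set X -> \bar R}) psi :
  bmeas psi -> (forall x A, measurable A -> `|fine (k x A) - fine (mu A)| <= psi x) ->
  (tv_norm (fun A => kact k nu1 nu2 A - (nu1 setT - nu2 setT) * mu A) <=
   (2 * (\int[nu1]_x psi x + \int[nu2]_x psi x))%R%:E)%E.
Proof.
move=> bpsi psiP; apply: ge_ereal_sup => _ [s [ms [ds _]] <-].
pose u A x := fine (k x A) - fine (mu A).
have nuP (nu : {finite_measure set X -> \bar R}) :
    \sum_(A <- s) `|\int[nu]_x u A x| <= 2 * \int[nu]_x psi x.
  have nuT : (nu setT < +oo)%E by rewrite ltey_eq fin_num_measure.
  (* Setting [v] to zero for sets outside [s] makes it bounded measurable for every index, as the
     finite sum rule requires. *)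
  pose v A x := if A \in s then `|u A x| else 0.
  have bv A : bmeas (v A).
    rewrite /v; case: (boolP (A \in s)) => [/ms mA|_]; last exact: bmeas_cst.
    exact/bmeas_norm/bmeas_pkerB.
  have [bsv isv] := Rint_sum nuT s bv.
  apply: (@le_trans _ _ (\int[nu]_x (\sum_(A <- s) v A x))).
    rewrite isv [leLHS]big_seq [leRHS]big_seq; apply: ler_sum => A sA.
    rewrite /v sA; apply: le_normr_Rintegral => //.
    exact/(bmeas_integrable nuT)/bmeas_pkerB/ms.
  rewrite mulr2n mulrDl mul1r -RintD//; apply: le_Rint => //; first exact: bmeasD.
  move=> x; rewrite big_seq (eq_bigr (fun A => `|u A x|)); last first.
    by move=> A; rewrite /v => ->.
  rewrite -big_seq -mulr2n -mulr_natl; apply: sum_norm_measureB_le => //.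
    exact: finite_kernel_measure.
  by move=> A; exact: psiP.
rewrite big_seq (eq_bigr (fun A => (`|\int[nu1]_x u A x - \int[nu2]_x u A x|)%:E));
  last by move=> A /ms mA; rewrite kactB.
rewrite -big_seq sumEFin lee_fin mulrDr.
apply: le_trans (lerD (nuP nu1) (nuP nu2)); rewrite -big_split/=.
by apply: ler_sum => A _; exact: ler_normB.
Qed.

Lemma tv_norm_ge0 (m : set X -> \bar R) : (0 <= tv_norm m)%E.
Proof.
apply: (@le_trans _ _ (\sum_(A <- [:: setT]) `|m A|)%E).
  by rewrite big_seq1 abse_ge0.
apply: ereal_sup_ubound; exists [:: setT] => //; split; [|split].
- by move=> A; rewrite inE => /eqP ->.
- by case=> [|i] [|j].
- by rewrite big_seq1.
Qed.

End total_variation.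

(** * From the discrete chain to the semigroup *)

Section semigroup.
Context {d} {X : measurableType d} {R : realType}.
Variables (k : R -> R.-pker X ~> X) (mu : probability X R) (t0 : R).
Hypothesis kD : forall t s, 0 <= t -> 0 <= s -> forall x A, measurable A ->
  k (t + s) x A = (\int[k s x]_y k t y A)%E.
Hypothesis kmu : forall t, 0 <= t -> forall A, measurable A ->
  (\int[mu]_x k t x A)%E = mu A.
Hypothesis t0_gt0 : 0 < t0.
Hypothesis kreg : forall x y, k t0 x `<< k t0 y.

Let muT : (mu setT < +oo)%E. Proof. by rewrite probability_setT ltey. Qed.

(** Both [k t x A] and [mu A] are averages of [k t0 y A] over a probability in [y]. By regularity
    that function vanishes everywhere as soon as it vanishes once, so either average is zero exactly
    when it vanishes identically. *)
Lemma regular_equiv_invariant t x : t0 <= t -> mu `<< k t x /\ k t x `<< mu.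
Proof.
move=> t0t; have t0_ge0 := ltW t0_gt0.
have ktE A : measurable A -> k t x A = (\int[k (t - t0) x]_y k t0 y A)%E.
  by move=> mA; rewrite -kD ?subr_ge0// addrC subrK.
have k0 A : measurable A -> (exists y, k t0 y A = 0%E) -> forall y, k t0 y A = 0%E.
  by move=> mA [y kyA] z; have /null_content_dominatesP := @kreg z y; exact.
split; apply/null_content_dominatesP => A mA A0.
  rewrite -(kmu t0_ge0 mA); apply: integral0_eq => y _; apply: k0 => //.
  apply: (@integral0_exists _ _ _ (k (t - t0) x)) => //.
  - by rewrite prob_kernel eqe oner_eq0.
  - exact: measurable_kernel.
  - by rewrite -ktE.
rewrite ktE//; apply: integral0_eq => y _; apply: k0 => //.
apply: (@integral0_exists _ _ _ mu) => //.
- by rewrite /= probability_setT eqe oner_eq0.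
- exact: measurable_kernel.
- by rewrite kmu.
Qed.

(** For [t] beyond [n.+1 * t0], the kernel at time [t] is the chain after [n.+1] steps applied to
    the test [k (t - n.+1 * t0) _ A]. Hence [psi n] covers all such real times at once. *)
Lemma doob_bound : exists psi : nat -> X -> R,
  [/\ forall n, measurable_fun setT (psi n),
      forall n x, `|psi n x| <= 1,
      forall x, psi n x @[n --> \oo] --> 0 &
      forall n t x A, n.+1%:R * t0 <= t -> measurable A ->
        `|fine (k t x A) - fine (mu A)| <= psi n x].
Proof.
have t0_ge0 := ltW t0_gt0; pose P n := k (n%:R * t0).
have nt0 n : 0 <= n%:R * t0 by rewrite mulr_ge0.
have PS n : n.+1%:R * t0 = t0 + n%:R * t0 by rewrite mulrS mulrDl mul1r.
have P1 : P 1%N = k t0 by rewrite /P mul1r.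
have [|||||psi [mpsi psi1 psi0 psiP]] := @doob_discrete _ _ _ P mu.
- by move=> n x A mA; rewrite P1 /P PS kD.
- by move=> n x A mA; rewrite P1 /P PS addrC kD.
- by move=> n A mA; exact: kmu.
- by move=> x; rewrite P1; case: (regular_equiv_invariant x (lexx t0)).
- by move=> x; rewrite P1; case: (regular_equiv_invariant x (lexx t0)).
exists psi; split=> // n t x A nt mA.
have := psiP n _ x (test_fine_pker (k (t - n.+1%:R * t0)) mA).
have r0 : 0 <= t - n.+1%:R * t0 by rewrite subr_ge0.
rewrite /dev -[X in X - _]/(fine (_%:E)) -integral_pkerE ?pkerT_lty// -kD// subrK.
by rewrite -[X in _ - X]/(fine (_%:E)) -integral_pkerE// kmu.
Qed.

Lemma regular_tv_cvg (nu1 nu2 : {finite_measure set X -> \bar R}) :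
  tv_norm (fun A => kact (k t) nu1 nu2 A - (nu1 setT - nu2 setT) * mu A)%E
    @[t --> +oo] --> 0%E.
Proof.
have [psi [mpsi psi1 psi0 psiP]] := doob_bound.
have icvg (nu : {finite_measure set X -> \bar R}) :
    \int[nu]_x psi n x @[n --> \oo] --> 0.
  apply: (Rint_cvg0 _ (C := 1)) => //; first by rewrite ltey_eq fin_num_measure.
  exact: aeW.
have bound e : 0 < e -> \forall t \near +oo,
    (tv_norm (fun A => kact (k t) nu1 nu2 A - (nu1 setT - nu2 setT) * mu A) <= e%:E)%E.
  move=> e0.
  have /cvgrPdist_le/(_ _ e0)[n _ /(_ n (leqnn n))] :
      2 * (\int[nu1]_x psi n x + \int[nu2]_x psi n x) @[n --> \oo] --> 0.
    by have := cvgM (cvg_cst (2 : R)) (cvgD (icvg nu1) (icvg nu2)); rewrite addr0 mulr0; apply.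
  rewrite sub0r normrN => /(le_trans (ler_norm _)) ne.
  have := nbhs_pinfty_ge (num_real (n.+1%:R * t0)); apply: filterS => t nt.
  apply: (@le_trans _ _
    (2 * (\int[nu1]_x psi n x + \int[nu2]_x psi n x))%:E); last by rewrite lee_fin.
  apply: tv_norm_kactB_le; first exact: bmeas_le (mpsi n) (psi1 n).
  by move=> x A; exact: psiP.
(* Convergence in the extended reals splits into eventual finiteness, given by the bound for
   [e = 1], and convergence of the real values. *)
apply/fine_cvgP; split.
  have := bound 1 ltr01; apply: filterS => t le1.
  by rewrite ge0_fin_numE ?tv_norm_ge0// (le_lt_trans le1)// ltey.
apply/cvgrPdist_le => e e0; have := bound e e0; apply: filterS => t le_e.
rewrite /= sub0r normrN ger0_norm ?fine_ge0 ?tv_norm_ge0//.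
rewrite -lee_fin fineK// ge0_fin_numE ?tv_norm_ge0//.
by rewrite (le_lt_trans le_e)// ltey.
Qed.

(** By invariance of [mu'], the difference [mu' A - mu A] is the [mu']-integral of [k t x A - mu A],
    hence bounded by the integrals of [psi n], which tend to zero. *)
Lemma regular_invariant_unique (mu' : probability X R) :
  (forall t, 0 <= t -> forall A, measurable A ->
    (\int[mu']_x k t x A)%E = mu' A) ->
  forall A, measurable A -> mu' A = mu A.
Proof.
move=> kmu' A mA.
have [psi [mpsi psi1 psi0 psiP]] := doob_bound.
have mu'T : (mu' setT < +oo)%E by rewrite probability_setT ltey.
have icvg : \int[mu']_x psi n x @[n --> \oo] --> 0.
  by apply: (Rint_cvg0 _ (C := 1)) => //; exact: aeW.
have le n : `|fine (mu' A) - fine (mu A)| <= \int[mu']_x psi n x.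
  have t_ge0 : 0 <= n.+1%:R * t0 by rewrite mulr_ge0// ltW.
  have := Rint_pkerB (k (n.+1%:R * t0)) mu mu' mA.
  have b := bmeas_pkerB (k (n.+1%:R * t0)) mu mA.
  rewrite kmu'//= probability_setT mul1e => mu'E.
  have := congr1 fine mu'E; rewrite fineB ?fin_num_measure//= => ->.
  apply: le_trans (le_normr_Rintegral _ _) _ => //.
    exact: bmeas_integrable.
  apply: le_Rint => //; [exact: bmeas_norm|exact: bmeas_le (mpsi n) (psi1 n)|].
  by move=> x; exact: psiP.
have : `|fine (mu' A) - fine (mu A)| <= 0.
  rewrite -(cvg_lim _ icvg)//; apply: limr_ge; first exact: cvgP icvg.
  exact: nearW.
rewrite normr_le0 subr_eq0 => /eqP mu'mu.
rewrite -(fineK (fin_num_measure mu' A mA)) mu'mu fineK//.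
exact: fin_num_measure.
Qed.

End semigroup.

Theorem theorem4p4 (R : realType) (Omega : completePseudoMetricType R)
  (k : R -> R.-pker borel Omega ~> borel Omega)
  (mu : probability (borel Omega) R) (t0 : R) :
  (* Omega is Polish: complete metric (above), Hausdorff, separable *)
  hausdorff_space Omega ->
  (exists D : set Omega, countable D /\ dense D) ->
  (* semigroup: T(0) = I *)
  (forall x A, measurable A -> k 0 x A = \d_x A) ->
  (* semigroup: T(t+s) = T(t) T(s), i.e. k_{t+s}(x,A) = \int k_t(y,A) k_s(x,dy) *)
  (forall t s, 0 <= t -> 0 <= s -> forall x A, measurable A ->
     k (t + s) x A = (\int[k s x]_y k t y A)%E) ->
  (* stochastic continuity *)
  (forall f : Omega -> R, continuous f -> (exists M, forall y, `|f y| <= M) ->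
     forall x : borel Omega,
       (fun t => (\int[k t x]_y (f y)%:E)%E) @ 0^'+ --> (f x)%:E) ->
  (* mu is invariant *)
  (forall t, 0 <= t -> forall A, measurable A -> (\int[mu]_x k t x A)%E = mu A) ->
  (* t0-regularity *)
  0 < t0 ->
  (forall x y, k t0 x `<< k t0 y /\ k t0 y `<< k t0 x) ->
  (* conclusions *)
  [/\ (forall nu1 nu2 : {finite_measure set borel Omega -> \bar R},
         (fun t => tv_norm (fun A =>
             (kact (k t) nu1 nu2 A - (nu1 setT - nu2 setT) * mu A)%E))
           @ +oo --> 0%E),
      (forall mu' : probability (borel Omega) R,
         (forall t, 0 <= t -> forall A, measurable A ->
            (\int[mu']_x k t x A)%E = mu' A) ->
         forall A, measurable A -> mu' A = mu A) &
      (forall t, t0 <= t -> forall x, mu `<< k t x /\ k t x `<< mu)].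
Proof.
move=> _ _ _ kD _ kmu t0_gt0 kreg.
have kreg' x y : k t0 x `<< k t0 y by case: (kreg x y).
split.
- exact: regular_tv_cvg kreg'.
- exact: regular_invariant_unique kreg'.
- by move=> t t0t x; exact: (regular_equiv_invariant kD kmu t0_gt0 kreg' x t0t).
Qed.
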